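(* Let $n$ be a large natural number and consider the $(1:S_b)$-biased games on $K_n$, where $S_b$ denotes the star with $b$ leaves. Then: (1) the threshold bias for the triangle game $\mathcal{F}_{K_3}(S_b,n)$ is $b=\Theta(n)$; (2) the threshold bias for the connectivity game $\mathcal{C}(S_b,n)$ is $b=\Theta(n)$; (3) the threshold bias for the Hamiltonicity game $\mathcal{H}(S_b,n)$ is $b=\Theta(n)$.
   Context: Structure-biased Maker-Breaker game on $K_n$: the board is the edge set of $K_n$; Maker and Breaker alternate turns; on each turn Maker claims one unclaimed edge, while Breaker claims a set of unclaimed edges forming a subgraph of a copy of a given graph $H$. For the $(1:S_b)$ bias, on each turn Breaker claims a set of at most $b$ unclaimed edges all incident to a common vertex (the center). The game ends when no unclaimed edges remain. In $\mathcal{F}_{K_3}$ Maker wins if her graph contains a triangle; in $\mathcal{C}$ Maker wins if her graph contains a spanning tree of $K_n$; in $\mathcal{H}$ Maker wins if her graph contains a Hamiltonian path of $K_n$; otherwise Breaker wins. The threshold bias is the value $b_0(n)$ such that Breaker wins if $b>b_0$ and Maker wins if $b\le b_0$. Convention: when considering Maker strategies Breaker makes the first move, and when considering Breaker strategies Maker makes the first move. *)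

(* Defs.v *)
From HB Require Import structures.
From mathcomp Require Import all_boot all_order all_algebra.
From mathcomp Require Import all_classical all_reals all_analysis.

Set Implicit Arguments.
Unset Strict Implicit.
Unset Printing Implicit Defensive.

Section Graphs.
Variable n : nat.

(* Simple graphs on the vertex set 'I_n are sets of two-element sets. *)
Definition graph := {set {set 'I_n}}.

Definition complete_graph : graph := [set e : {set 'I_n} | #|e| == 2].

Definition adj (G : graph) : rel 'I_n :=
  fun x y => (x != y) && ([set x; y] \in G).

Definition has_triangle (G : graph) : Prop :=
  exists x y z : 'I_n, [/\ adj G x y, adj G y z & adj G z x].

Definition connected_graph (G : graph) : Prop :=
  forall x y : 'I_n, connect (adj G) x y.

(* The bound on the size excludes [:: x; y], which [cycle] accepts whenever
   x and y are adjacent. *)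
Definition acyclic_graph (G : graph) : Prop :=
  forall c : seq 'I_n, 2 < size c -> uniq c -> ~~ cycle (adj G) c.

Definition has_spanning_tree (G : graph) : Prop :=
  exists T : graph, [/\ T \subset G, connected_graph T & acyclic_graph T].

Definition has_hamiltonian_path (G : graph) : Prop :=
  exists p : seq 'I_n, [/\ uniq p, p =i 'I_n & sorted (adj G) p].

End Graphs.

Variant player := Maker | Breaker.

Section Game.
Variables (n b : nat).
(* W is the property of Maker's final graph that makes her the winner. *)
Variable W : graph n -> Prop.

Definition unclaimed (M B : graph n) : graph n :=
  complete_graph n :\: (M :|: B).

Definition breaker_move (M B S : graph n) : Prop :=
  [/\ S \subset unclaimed M B, #|S| <= b
    & exists v : 'I_n, forall e, e \in S -> v \in e].

(* [maker_wins p M B] (resp. [breaker_wins p M B]): Maker (resp. Breaker) has a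
   winning strategy from the position in which Maker has claimed M, Breaker has
   claimed B, and p is to move. *)
Inductive maker_wins : player -> graph n -> graph n -> Prop :=
| maker_wins_end p M B :
    unclaimed M B = finset.set0 -> W M -> maker_wins p M B
| maker_wins_Maker M B e :
    e \in unclaimed M B -> maker_wins Breaker (e |: M) B ->
    maker_wins Maker M B
| maker_wins_Breaker M B :
    unclaimed M B <> finset.set0 ->
    (forall S, breaker_move M B S -> maker_wins Maker M (B :|: S)) ->
    maker_wins Breaker M B.

Inductive breaker_wins : player -> graph n -> graph n -> Prop :=
| breaker_wins_end p M B :
    unclaimed M B = finset.set0 -> ~ W M -> breaker_wins p M B
| breaker_wins_Maker M B :
    unclaimed M B <> finset.set0 ->
    (forall e, e \in unclaimed M B -> breaker_wins Breaker (e |: M) B) ->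
    breaker_wins Maker M B
| breaker_wins_Breaker M B S :
    unclaimed M B <> finset.set0 ->
    breaker_move M B S -> breaker_wins Maker M (B :|: S) ->
    breaker_wins Breaker M B.

End Game.

Definition threshold_bias (first : player) n (W : graph n -> Prop) (b0 : nat) :
    Prop :=
  forall b,
    (b0 < b -> breaker_wins b W first finset.set0 finset.set0) /\
    (b <= b0 -> maker_wins b W first finset.set0 finset.set0).

(* Main.v *)
Require Import Defs.
From mathcomp Require Import all_boot zify.
From Stdlib Require Import Classical_Prop.

(** Since Breaker may pass, Maker's chances are monotone in the bias, and a finite
game is determined; so it suffices that Breaker wins for [b > n] and Maker wins
for [b <= n / C].

Breaker isolates a vertex, or, in the triangle game, answers every Maker edge by
claiming all free edges at one of its endpoints.

In the triangle game Maker builds a star, always choosing a new leaf that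
creates a threat; the forced answer is a star centred at a leaf, so it never
touches the centre of Maker's star, and after [2 b + 1] steps some leaf creates
more than [b] threats.

In the Hamiltonicity game Maker keeps a cyclic ordering of the vertices and counts
its gaps, the consecutive pairs that she does not own; at most one gap means a
Hamiltonian path.  Joining an end [p] of a gap to a suitable vertex [w] either
moves the gap away from [p], or, if no vertex at a gap has large Breaker degree,
threatens to remove a gap through two disjoint edges, which no star contains.
Answering first at the centre of Breaker's last star keeps the Breaker degrees at
all gaps a small fraction of [n]: the other vertices gain only one per turn, and
only few vertices ever need such an answer. *)

Set Implicit Arguments.
Unset Strict Implicit.
Unset Printing Implicit Defensive.

(* Cardinals elaborated in different ways differ by unfoldings of the canonical
   [finType] instances, and [lia] would see distinct atoms. *)
Ltac card_norm :=
  unfold reverse_coercion in *;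
  cbn [Finite.sort Equality.sort fintype_Finite__to__eqtype_Equality
       finset_set_of__canonical__fintype_Finite
       fintype_ordinal__canonical__fintype_Finite] in *.
Ltac card_lia := card_norm; lia.
Ltac card_nia := card_norm; nia.

(** * Games *)

Section GameGeneral.
Variable n : nat.
Implicit Types (M B S : graph n) (W : graph n -> Prop) (e : {set 'I_n}).

Definition monotone_property W := forall M M', M \subset M' -> W M -> W M'.

Lemma in_unclaimed M B e :
  (e \in unclaimed M B) = [&& e \notin M, e \notin B & e \in complete_graph n].
Proof. by rewrite !inE negb_or -andbA. Qed.

Lemma in_complete x y : ([set x; y] \in complete_graph n) = (x != y).
Proof. by rewrite inE cards2 eqSS eqb1. Qed.

Lemma breaker_move0 b M B : (0 < n) -> breaker_move b M B set0.
Proof.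
move=> n0; split; rewrite ?sub0set ?cards0 //.
by exists (Ordinal n0) => e; rewrite inE.
Qed.

Lemma breaker_move_leq b b' M B S :
  b <= b' -> breaker_move b M B S -> breaker_move b' M B S.
Proof. by move=> le_b [SU cardS vS]; split=> //; apply: leq_trans le_b. Qed.

Lemma unclaimed_card_gt0 M B : unclaimed M B <> set0 -> 0 < n.
Proof.
move=> /eqP/set0Pn[e]; rewrite in_unclaimed inE => /and3P[_ _ /eqP e2].
by have := max_card e; rewrite card_ord e2; lia.
Qed.

Lemma card_unclaimed_claim M B e :
  e \in unclaimed M B -> #|unclaimed (e |: M) B| < #|unclaimed M B|.
Proof.
move=> eU; apply: proper_card; apply/properP; split.
  apply/subsetP=> f; rewrite !in_unclaimed !inE negb_or.
  by case/and3P=> /andP[_ ->] -> ->.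
by exists e => //; rewrite in_unclaimed setU11.
Qed.

Lemma card_unclaimed_breaker M B S :
  #|unclaimed M (B :|: S)| <= #|unclaimed M B|.
Proof.
apply: subset_leq_card; apply/subsetP=> f; rewrite !in_unclaimed !inE negb_or.
by case/and3P=> -> /andP[-> _] ->.
Qed.

Lemma maker_wins_leq b b' W p M B :
  b' <= b -> maker_wins b W p M B -> maker_wins b' W p M B.
Proof.
move=> le_b; elim=> {p M B} [p M B|M B e eU _|M B U0 _ IH].
- exact: maker_wins_end.
- exact: maker_wins_Maker.
- by apply: maker_wins_Breaker => // S /(breaker_move_leq le_b); apply: IH.
Qed.

Lemma maker_wins_weaken b W W' p M B :
  (forall M, W M -> W' M) -> maker_wins b W p M B -> maker_wins b W' p M B.
Proof.
move=> WW'; elim=> {p M B} [p M B U0 /WW'|M B e eU _|M B U0 _ IH].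
- exact: maker_wins_end.
- exact: maker_wins_Maker.
- exact: maker_wins_Breaker.
Qed.

Lemma breaker_wins_weaken b W W' p M B :
  (forall M, W' M -> W M) -> breaker_wins b W p M B -> breaker_wins b W' p M B.
Proof.
move=> WW'; elim=> {p M B} [p M B U0 nW|M B U0 _ IH|M B S U0 SB _ IH].
- by apply: breaker_wins_end => // /WW'.
- exact: breaker_wins_Maker.
- exact: breaker_wins_Breaker SB IH.
Qed.

(** [W] is tested only on a full board, and monotonicity lets Maker claim arbitrary edges until
    then. Only her moves are sure to use up free edges, so her turn is settled first, for every [B']
    leaving no more of them. *)
Lemma maker_wins_now b W p M B : monotone_property W -> W M ->
  maker_wins b W p M B.
Proof.
move=> Wmono; have [k] := ubnP #|unclaimed M B|.
elim: k => // k IHk in p M B * => lt_k WM.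
have claim B' : #|unclaimed M B'| <= #|unclaimed M B| -> maker_wins b W Maker M B'.
  move=> le_B'; have [U0|/set0Pn[e eU]] := eqVneq (unclaimed M B') set0.
    exact: maker_wins_end.
  apply: (maker_wins_Maker eU); apply: IHk.
    exact: leq_trans (card_unclaimed_claim eU) (leq_trans le_B' _).
  by apply: (Wmono _ _ _ WM); apply: subsetUr.
case: p; first exact: claim.
have [U0|/eqP U0] := eqVneq (unclaimed M B) set0; first exact: maker_wins_end.
by apply: maker_wins_Breaker => // S _; apply/claim/card_unclaimed_breaker.
Qed.

(** Follows the branch of the strategy in which Breaker always passes. On a full board it yields
    [W M]. *)
Lemma maker_wins_all b W p M B : monotone_property W ->
  maker_wins b W p M B -> W (M :|: unclaimed M B).
Proof.
move=> Wmono; elim=> {p M B} [p M B _|M B e eU _|M B U0 _ IH].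
- exact/Wmono/subsetUl.
- apply: (Wmono); apply/subsetP=> f; rewrite !in_setU in_set1 !in_unclaimed.
  rewrite in_setU1 negb_or.
  case/orP=> [/orP[/eqP->|->//]|/and3P[/andP[_ ->] -> ->]]; last by rewrite orbT.
  by rewrite -in_unclaimed eU orbT.
- have := IH set0 (breaker_move0 b M B (unclaimed_card_gt0 U0)).
  by rewrite setU0.
Qed.

(** Maker imagines the position with [M] and [B], where Breaker's move [S] becomes [S :\: B]. When
    the imagined strategy asks for an edge that she already owns, she claims any free one. *)
Lemma maker_wins_mono b W p M B M' B' : monotone_property W ->
  maker_wins b W p M B -> M \subset M' -> B' \subset B -> maker_wins b W p M' B'.
Proof.
move=> Wmono win; elim: win M' B' => {p M B}.
- move=> p M B _ WM M' B' MM' _; apply: maker_wins_now => //.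
  exact: (Wmono _ _ MM' WM).
- move=> M B e eU win IH M' B' MM' BB'.
  have [eM'|eM'] := boolP (e \in M'); last first.
    apply: (@maker_wins_Maker _ _ _ _ _ e); last first.
      by apply: IH => //; apply: setUS.
    move: eU; rewrite !in_unclaimed eM' => /and3P[_ eB ->]; rewrite andbT.
    by apply: contraNN eB; apply: (subsetP BB').
  have eMM' : e |: M \subset M' by rewrite subUset sub1set eM' MM'.
  have [U0|/set0Pn[f fU]] := eqVneq (unclaimed M' B') set0.
    have := maker_wins_all Wmono (IH _ _ eMM' BB').
    by rewrite U0 setU0; apply: maker_wins_end.
  apply: (maker_wins_Maker fU); apply: IH => //.
  by apply: subset_trans eMM' _; apply: subsetUr.
- move=> M B U0 win IH M' B' MM' BB'.
  have [U0'|/eqP U0'] := eqVneq (unclaimed M' B') set0.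
    have n_gt0 := unclaimed_card_gt0 U0.
    have := IH set0 (breaker_move0 b M B n_gt0) M' B' MM'.
    rewrite setU0 => /(_ BB')/(maker_wins_all Wmono).
    by rewrite U0' setU0; apply: maker_wins_end.
  apply: maker_wins_Breaker => // S [/subsetP SU cS [v vS]].
  apply: (IH (S :\: B)) => //; last first.
    by apply/subsetP=> e /setUP[/(subsetP BB')|] eB; rewrite !inE eB ?andbT ?orbN.
  split; last by exists v => e /setDP[/vS].
    apply/subsetP=> e /setDP[/SU eU eB].
    move: eU; rewrite !in_unclaimed eB => /and3P[eM' _ ->]; rewrite !andbT.
    by apply: contraNN eM'; apply: (subsetP MM').
  by apply: leq_trans cS; apply/subset_leq_card/subsetDl.
Qed.

Lemma maker_wins_pass b W M B : monotone_property W ->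
  maker_wins b W Breaker M B -> maker_wins b W Maker M B.
Proof.
move=> Wmono win; have [U0|/set0Pn[e eU]] := eqVneq (unclaimed M B) set0.
  have := maker_wins_all Wmono win.
  by rewrite U0 setU0; apply: maker_wins_end.
apply: (maker_wins_Maker eU); apply: maker_wins_mono win _ _ => //.
exact: subsetUr.
Qed.

Lemma maker_wins_claim b W M B e : monotone_property W ->
  e \in complete_graph n -> e \notin B -> maker_wins b W Breaker (e |: M) B ->
  maker_wins b W Maker M B.
Proof.
move=> Wmono eK eB win; have [eM|eM] := boolP (e \in M).
  by apply: maker_wins_pass => //; move: win; rewrite (setUidPr _) ?sub1set.
by apply: maker_wins_Maker win; rewrite in_unclaimed eM eB.
Qed.

Lemma maker_wins_reply b W M B : monotone_property W ->
  (forall S, breaker_move b M B S -> maker_wins b W Maker M (B :|: S)) ->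
  0 < n -> maker_wins b W Breaker M B.
Proof.
move=> Wmono win n_gt0.
have [U0|/eqP U0] := eqVneq (unclaimed M B) set0; last exact: maker_wins_Breaker.
have := win set0 (breaker_move0 b M B n_gt0).
by rewrite setU0 => /(maker_wins_all Wmono); rewrite U0 setU0; apply: maker_wins_end.
Qed.

Lemma maker_wins_first b W p : monotone_property W ->
  maker_wins b W Breaker set0 set0 -> maker_wins b W p set0 set0.
Proof. by case: p => // Wmono; apply: maker_wins_pass. Qed.

(** The current [B] already meets every winning graph, so Breaker passes until the end. *)
Lemma breaker_wins_blocked b W p M B : [disjoint M & B] ->
  (forall M', [disjoint M' & B] -> ~ W M') -> breaker_wins b W p M B.
Proof.
move=> MB nW; have [k] := ubnP #|unclaimed M B|.
elim: k => // k IHk in p M MB * => lt_k.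
have [U0|/eqP U0] := eqVneq (unclaimed M B) set0.
  exact/breaker_wins_end/nW.
have claim : breaker_wins b W Maker M B.
  apply: breaker_wins_Maker => // e eU; apply: IHk; last first.
    exact: leq_trans (card_unclaimed_claim eU) _.
  move: eU; rewrite in_unclaimed => /and3P[_ eB _].
  by rewrite -setI_eq0 setIUl setU_eq0 !setI_eq0 disjoints1 eB.
case: p => //; have n_gt0 := unclaimed_card_gt0 U0.
apply: (breaker_wins_Breaker U0 (breaker_move0 b M B n_gt0)).
by rewrite setU0.
Qed.

(** Backward induction on the number of free edges. A pass does not decrease it, so Maker's turn is
    settled first, in [claim]. *)
Lemma game_determined b W p M B :
  maker_wins b W p M B \/ breaker_wins b W p M B.
Proof.
have [k] := ubnP #|unclaimed M B|.
elim: k => // k IHk in p M B * => lt_k.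
have [U0|/eqP U0] := eqVneq (unclaimed M B) set0.
  have [WM|nWM] := classic (W M); first by left; apply: maker_wins_end.
  by right; apply: breaker_wins_end.
have claim B' : #|unclaimed M B'| <= #|unclaimed M B| ->
    maker_wins b W Maker M B' \/ breaker_wins b W Maker M B'.
  move=> le_B'; have [U0'|/eqP U0'] := eqVneq (unclaimed M B') set0.
    have [WM|nWM] := classic (W M); first by left; apply: maker_wins_end.
    by right; apply: breaker_wins_end.
  have [[e [eU win]]|nwin] :=
      classic (exists e, e \in unclaimed M B' /\ maker_wins b W Breaker (e |: M) B').
    by left; apply: maker_wins_Maker win.
  right; apply: breaker_wins_Maker => // e eU.
  have [] // := IHk Breaker (e |: M) B'.
    exact: leq_trans (card_unclaimed_claim eU) (leq_trans le_B' _).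
  by move=> win; case: nwin; exists e.
case: p; first exact: claim.
have [[S [SB win]]|nwin] :=
    classic (exists S, breaker_move b M B S /\ breaker_wins b W Maker M (B :|: S)).
  by right; apply: breaker_wins_Breaker win.
left; apply: maker_wins_Breaker => // S SB.
have [] // := claim (B :|: S); first exact: card_unclaimed_breaker.
by move=> win; case: nwin; exists S.
Qed.

(* Only biases [b <= n] need to be searched for the threshold, because Breaker
   wins for all larger ones. *)
Lemma threshold_exists c p W : c <= n ->
  maker_wins c W p set0 set0 ->
  (forall b, n < b -> breaker_wins b W p set0 set0) ->
  exists2 b0, c <= b0 <= n & threshold_bias p W b0.
Proof.
move=> le_cn win_c lose.
have [k] := ubnP (n - c); elim: k => // k IHk in c le_cn win_c *.
move=> lt_k; have [win|nwin] := classic (c < n /\ maker_wins c.+1 W p set0 set0).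
  case: win => lt_cn win; have [] := IHk c.+1 lt_cn win; first by lia.
  by move=> b0 /andP[c_b0 b0n] thr; exists b0 => //; rewrite b0n ltnW.
exists c; first by rewrite leqnn.
move=> b; split=> [lt_cb|le_bc]; last exact: maker_wins_leq win_c.
have [lt_nb|le_bn] := ltnP n b; first exact: lose.
have [win|//] := game_determined b W p set0 set0.
by case: nwin; split; [exact: leq_trans le_bn|exact: maker_wins_leq win].
Qed.

End GameGeneral.

(** * Breaker's strategies *)

Lemma sorted_connect (T : finType) (e : rel T) (p : seq T) (x y : T) :
  connect_sym e -> sorted e p -> x \in p -> y \in p -> connect e x y.
Proof.
case: p => // x0 t e_sym p_path xp yp.
have conn z : z \in x0 :: t -> connect e x0 z by move/(path_connect p_path).
by apply: connect_trans (conn y yp); rewrite e_sym conn.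
Qed.

Section Properties.
Variable n : nat.
Implicit Types (M B S G : graph n) (x y z v : 'I_n).

Lemma adj_sub G G' : G \subset G' -> subrel (adj G) (adj G').
Proof. by move=> /subsetP GG' x y /andP[xy /GG']; rewrite /adj xy. Qed.

Lemma adj_sym G : symmetric (adj G).
Proof. by move=> x y; rewrite /adj eq_sym setUC. Qed.

Lemma has_triangle_mono : monotone_property (@has_triangle n).
Proof.
move=> G G' /adj_sub GG' [x [y [z [xy yz zx]]]].
by exists x, y, z; split; apply: GG'.
Qed.

Lemma has_hamiltonian_path_mono : monotone_property (@has_hamiltonian_path n).
Proof.
move=> G G' /adj_sub GG' [p [p_uniq p_all p_path]].
by exists p; split=> //; apply: sub_sorted p_path.
Qed.

(* The element of smallest index on a cycle inside a path would need two
   distinct neighbours of index one larger. *)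
Lemma hamiltonian_spanning_tree G : has_hamiltonian_path G -> has_spanning_tree G.
Proof.
move=> [p [p_uniq p_all p_path]].
have p_mem x : x \in p by rewrite p_all.
have eq_ix x y : index x p = index y p -> x = y.
  by move=> xy; rewrite -(nth_index x (p_mem x)) xy nth_index.
pose T : graph n :=
  [set e in G | [exists x, exists y, (e == [set x; y]) && (index y p == (index x p).+1)]].
have adjT x y : adj T x y -> index y p = (index x p).+1 \/ index x p = (index y p).+1.
  case/andP=> xy; rewrite inE => /andP[_ /existsP[a /existsP[c /andP[/eqP xyE /eqP ac]]]].
  have : x \in [set a; c] by rewrite -xyE set21.
  have : y \in [set a; c] by rewrite -xyE set22.
  rewrite !inE => /orP[]/eqP ya /orP[]/eqP xa; subst; rewrite ?eqxx // in xy *; auto.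
have T_path : sorted (adj T) p.
  case: p p_path @T {p_mem p_all eq_ix adjT} p_uniq => // x0 t /(pathP x0) p_path T p_uniq.
  apply/(pathP x0) => i lt_i; have := p_path i lt_i.
  case/andP=> neq inG; rewrite /adj neq inE inG !andTb.
  apply/existsP; exists (nth x0 (x0 :: t) i); apply/existsP; exists (nth x0 t i).
  rewrite eqxx -[nth x0 t i]/(nth x0 (x0 :: t) i.+1).
  by rewrite !index_uniq //=; lia.
exists T; split.
- by apply/subsetP=> e; rewrite inE => /andP[].
- have symT : connect_sym (adj T) by exact/sym_connect_sym/adj_sym.
  by move=> x y; apply: sorted_connect T_path (p_mem x) (p_mem y).
- move=> c c_size c_uniq; apply/negP=> c_cycle.
  have c_gt0 : exists i, [exists x, (x \in c) && (index x p == i)].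
    case: c c_size {c_uniq c_cycle} => // x c _; exists (index x p).
    by apply/existsP; exists x; rewrite mem_head eqxx.
  case: (ex_minnP c_gt0) => i /existsP[x /andP[xc /eqP xi]] min_i.
  have up y : y \in c -> adj T x y -> index y p = i.+1.
    move=> yc /adjT[]; rewrite xi // => iy.
    have : i <= index y p; last by lia.
    by apply: min_i; apply/existsP; exists y; rewrite yc eqxx.
  have nx := next_cycle c_cycle xc; have px := prev_cycle c_cycle xc.
  have eq_np : next c x = prev c x.
    apply: eq_ix; rewrite !up ?mem_next ?mem_prev //.
    by rewrite adj_sym.
  have nnx : next c (next c x) = x by rewrite eq_np next_prev.
  have [k t ct] := rot_to xc.
  have nE z : next c z = next (x :: t) z by rewrite -ct next_rot.
  move: nnx; rewrite !nE.
  have: uniq (x :: t) by rewrite -ct rot_uniq.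
  have: 2 < size (x :: t) by rewrite -ct size_rot.
  case: t {ct nE} => [|y [|z t]] //= _; rewrite !inE !negb_or eqxx.
  case/andP=> /and3P[xy xz _] _; rewrite eq_sym (negPf xy) eqxx => zx.
  by rewrite zx eqxx in xz.
Qed.

(** * Isolating a vertex *)

Definition star v : graph n := [set e in complete_graph n | v \in e].

Lemma in_star v e : (e \in star v) = (e \in complete_graph n) && (v \in e).
Proof. by rewrite inE. Qed.

Lemma edge_at e v : e \in complete_graph n -> v \in e ->
  exists2 u, u != v & e = [set v; u].
Proof.
rewrite inE => /cards2P[x [y [xy ->]]]; rewrite !inE.
by case/orP=> /eqP->; [exists y; rewrite 1?eq_sym|exists x; rewrite // setUC].
Qed.

Lemma card_star v : #|star v| <= n.
Proof.
rewrite -[X in _ <= X]card_ord -cardsT.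
apply: leq_trans (leq_imset_card (fun u => [set v; u]) _).
apply/subset_leq_card/subsetP=> e; rewrite inE => /andP[eK ve].
by have [u _ ->] := edge_at eK ve; apply: imset_f; rewrite inE.
Qed.

(** One move claims the whole star at a vertex [v] that Maker has not touched, and then no path of
    hers leaves [v]. If she moves first, [v] is chosen off her edge. *)
Lemma breaker_wins_isolate b p : 2 < n -> n <= b ->
  breaker_wins b (@has_spanning_tree n) p set0 set0.
Proof.
move=> n_gt2 le_nb.
have block M v : (forall e, e \in M -> v \notin e) -> M \subset complete_graph n ->
    breaker_wins b (@has_spanning_tree n) Breaker M set0.
  move=> Mv MK; have v1: exists u, u != v.
    have : 0 < #|[set~ v]| by rewrite cardsC1 card_ord; lia.
    by case/card_gt0P=> u; rewrite !inE; exists u.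
  have sU : star v \subset unclaimed M set0.
    apply/subsetP=> e; rewrite in_star in_unclaimed in_set0 => /andP[-> ve]; rewrite !andbT.
    by apply: (contraTN _ ve) => /Mv.
  have sn0 : unclaimed M set0 <> set0.
    case: v1 => u uv; apply/eqP/set0Pn; exists [set v; u]; apply: (subsetP sU).
    by rewrite in_star in_complete eq_sym uv set21.
  apply: (@breaker_wins_Breaker _ _ _ _ _ (star v)) => //.
    split=> //; first exact: leq_trans (card_star v) le_nb.
    by exists v => e; rewrite inE => /andP[].
  rewrite set0U; apply: breaker_wins_blocked => [|M' M'S [T [TM' T_conn _]]].
    rewrite disjoint_sym disjoints_subset; apply/subsetP=> e.
    by move/(subsetP sU); rewrite in_unclaimed in_setC => /and3P[].
  case: v1 => u uv; have /connectP[[|w q] /= T_path uE] := T_conn v u.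
    by rewrite uE eqxx in uv.
  case/andP: T_path => /andP[vw /(subsetP TM') vwM'] _.
  have /negP[] : [set v; w] \notin star v by rewrite (disjointFr M'S).
  by rewrite in_star in_complete vw set21.
case: p; last first.
  by apply: (@block set0 (Ordinal (ltnW (ltnW n_gt2)))); rewrite ?sub0set // => e; rewrite inE.
have U0 : unclaimed set0 set0 <> set0 :> graph n.
  apply/eqP/set0Pn; exists [set Ordinal (ltnW (ltnW n_gt2)); Ordinal n_gt2].
  by rewrite in_unclaimed !inE cards2.
apply: breaker_wins_Maker => // e; rewrite in_unclaimed => /and3P[_ _ eK].
have : 0 < #|~: e|.
  by move: eK; rewrite inE => /eqP e2; have := cardsC e; rewrite e2 card_ord; lia.
case/card_gt0P=> v; rewrite inE => ve; apply: (@block _ v).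
  by move=> f; rewrite setU0 inE => /eqP->.
by rewrite setU0 sub1set.
Qed.

(** * Closing an endpoint of every Maker edge *)

Definition closed_vertex M B v := forall e, e \in unclaimed M B -> v \notin e.

(** The position before Maker's turns. A free edge has two open ends, so by the second clause all
    Maker neighbours of these ends are closed; this carries the condition through her next move. *)
Definition triangle_blocked M B :=
  [/\ ~ has_triangle M,
      forall x y, adj M x y -> closed_vertex M B x \/ closed_vertex M B y
    & forall x y z, adj M x z -> adj M z y -> [set x; y] \notin unclaimed M B].

(* If [[set x; z]] is a Maker edge while [x] is still open, then [z] is closed;
   hence [[set x; y]] creates no threat at [y], and closing [x] removes those at [x]. *)
Lemma triangle_blocked_step M B e x : e \in unclaimed M B -> x \in e ->
  triangle_blocked M B ->
  triangle_blocked (e |: M) (B :|: (star x :&: unclaimed (e |: M) B)).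
Proof.
move=> eU xe [ntri closed nthreat].
have eK : e \in complete_graph n by move: eU; rewrite in_unclaimed => /and3P[].
have [y yx eE] := edge_at eK xe; set M' := e |: M; set B' := B :|: _.
have eqE a c : [set a; c] = e -> (a = x /\ c = y) \/ (a = y /\ c = x).
  move=> acE; have : a \in [set x; y] by rewrite -eE -acE set21.
  have : c \in [set x; y] by rewrite -eE -acE set22.
  have ac : a != c by rewrite -in_complete acE.
  by rewrite !inE => /orP[]/eqP ? /orP[]/eqP ?; subst; rewrite ?eqxx in ac; auto.
have adjM' a c : adj M' a c -> adj M a c \/ [set a; c] = e.
  by case/andP=> ac; rewrite !inE => /orP[/eqP|acM]; [right|left; rewrite /adj ac].
have U' f : f \in unclaimed M' B' -> f \in unclaimed M B /\ x \notin f.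
  rewrite in_unclaimed => /and3P[fM']; rewrite in_setU negb_or => /andP[fB].
  rewrite in_setI in_star [f \in unclaimed M' B]in_unclaimed fM' fB => + fK.
  rewrite fK andTb !andbT => xf; split=> //; rewrite in_unclaimed fB fK !andbT.
  by move: fM'; rewrite in_setU1 negb_or => /andP[].
have closed' a : closed_vertex M B a -> closed_vertex M' B' a.
  by move=> cl f /U'[/cl].
have x_open : ~ closed_vertex M B x by move/(_ _ eU); rewrite xe.
have y_open : ~ closed_vertex M B y by move/(_ _ eU); rewrite eE set22.
have ex_threat a c z : [set a; c] = e -> adj M c z -> adj M z a -> False.
  by move=> acE cz za; have := nthreat _ _ _ cz za; rewrite setUC acE eU.
have two a c z : [set a; c] = e -> [set c; z] = e -> a = z.
  by case/eqE=> [[-> ->]|[-> ->]] /eqE[[xy ->]|[xy ->]] //; rewrite xy eqxx in yx.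
split.
- move=> [a [c [z [ac cz za]]]].
  have neq u v : adj M' u v -> u <> v by case/andP=> /eqP.
  have nac := neq _ _ ac; have ncz := neq _ _ cz; have nza := neq _ _ za.
  (* The cases are sorted by the sides that equal the new edge: with one such side there was a
     threat before, with two the triangle degenerates. *)
  case/adjM': ac => [ac|ac]; case/adjM': cz => [cz|cz]; case/adjM': za => [za|za].
  + by apply: ntri; exists a, c, z.
  + exact: ex_threat za ac cz.
  + exact: ex_threat cz za ac.
  + by case: nac; rewrite (two _ _ _ cz za).
  + exact: ex_threat ac cz za.
  + by case: ncz; rewrite (two _ _ _ za ac).
  + by case: nza; rewrite (two _ _ _ ac cz).
  + by case: nza; rewrite (two _ _ _ ac cz).
- move=> a c /adjM'[/closed[]|/eqE[[-> _]|[_ ->]]]; auto.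
    by left=> f /U'[].
  by right=> f /U'[].
(* The free edge avoids the closed [x], so the new edge can only enter with [x] in the middle; the
   old edge at [x] would then have had two open ends. *)
- move=> a c z /adjM' az /adjM' zc; apply/negP=> /U'[acU xac].
  have open u : u \in [set a; c] -> ~ closed_vertex M B u.
    by move=> uac /(_ _ acU); rewrite uac.
  have [ax cx] : x <> a /\ x <> c.
    by split=> xE; rewrite xE ?set21 ?set22 in xac.
  case: az => [az|/eqE[[xE]|[aE zE]]]; last 2 first.
  + by case: ax.
  + case: zc => [|/eqE[[_ cE]|[_ xE]]]; last by case: cx.
      by rewrite zE => /closed[//|]; apply: open; rewrite set22.
    by move: acU; rewrite in_unclaimed in_complete aE cE eqxx !andbF.
  case: zc => [zc|/eqE[[zE _]|[_ xE]]]; last by case: cx.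
    by have := nthreat _ _ _ az zc; rewrite acU.
  by move: az; rewrite zE => /closed[|//]; apply: open; rewrite set21.
Qed.

Lemma breaker_wins_triangle b p : n <= b ->
  breaker_wins b (@has_triangle n) p set0 set0.
Proof.
move=> le_nb.
have win M B : triangle_blocked M B -> breaker_wins b (@has_triangle n) Maker M B.
  have [k] := ubnP #|unclaimed M B|.
  elim: k => // k IHk in M B * => lt_k MB.
  have [U0|/eqP U0] := eqVneq (unclaimed M B) set0.
    by apply: breaker_wins_end => //; case: MB.
  apply: breaker_wins_Maker => // e eU.
  have /card_gt0P[x xe] : 0 < #|e|.
    by move: (eU); rewrite in_unclaimed inE => /and3P[_ _ /eqP->].
  have MB' := triangle_blocked_step eU xe MB.
  have [U0'|/eqP U0'] := eqVneq (unclaimed (e |: M) B) set0.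
    by apply: breaker_wins_end => //; case: MB'.
  apply: (@breaker_wins_Breaker _ _ _ _ _ (star x :&: unclaimed (e |: M) B)) => //.
    split; first exact: subsetIr; last first.
      by exists x => f; rewrite inE in_star => /andP[/andP[]].
    apply: leq_trans le_nb; apply: leq_trans (card_star x).
    exact/subset_leq_card/subsetIl.
  apply: IHk MB'; apply: leq_ltn_trans (card_unclaimed_breaker _ _ _) _.
  exact: leq_trans (card_unclaimed_claim eU) _.
have init : triangle_blocked set0 set0.
  have nadj x y : adj set0 x y = false by rewrite /adj inE andbF.
  by split=> [[x [y [z []]]]|x y|x y z]; rewrite nadj.
case: p; first exact: win.
have [U0|/eqP U0] := eqVneq (unclaimed (set0 : graph n) set0) set0.
  by apply: breaker_wins_end => //; case: init.
have n_gt0 := unclaimed_card_gt0 U0.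
apply: (breaker_wins_Breaker U0 (breaker_move0 b _ _ n_gt0)).
by rewrite setU0; apply: win.
Qed.

End Properties.

(** * The triangle game *)

Section Degrees.
Variable n : nat.
Implicit Types (M B S G : graph n) (x y z v c : 'I_n).

Definition neighbours B v := [set u | [set v; u] \in B].

Definition degree B v := #|neighbours B v|.

Lemma set2_inj v x y : [set v; x] = [set v; y] -> x = y.
Proof.
move=> E; have : x \in [set v; y] by rewrite -E set22.
have : y \in [set v; x] by rewrite E set22.
by rewrite !inE => /orP[]/eqP yE /orP[]/eqP xE; subst.
Qed.

Lemma degree_leq_card B v : degree B v <= #|B|.
Proof.
rewrite /degree -(card_imset _ (@set2_inj v)); apply/subset_leq_card/subsetP.
by move=> e /imsetP[u]; rewrite inE => uB ->.
Qed.

Lemma degree_mono B B' v : B \subset B' -> degree B v <= degree B' v.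
Proof.
by move/subsetP=> BB'; apply/subset_leq_card/subsetP=> u; rewrite !inE => /BB'.
Qed.

Lemma degreeU B S v : degree (B :|: S) v <= degree B v + degree S v.
Proof.
apply: leq_trans (leq_card_setU _ _); apply/subset_leq_card/subsetP=> u.
by rewrite !inE.
Qed.

Lemma degree_star S c v : (forall e, e \in S -> c \in e) -> v != c -> degree S v <= 1.
Proof.
move=> cS vc; rewrite -(cards1 c); apply/subset_leq_card/subsetP=> u.
by rewrite !inE => /cS; rewrite !inE eq_sym (negPf vc) eq_sym.
Qed.

Lemma sum_card_pairs (A : {set 'I_n}) (F : 'I_n -> {set 'I_n}) :
  \sum_(x in A) #|F x| = #|[set p | (p.1 \in A) && (p.2 \in F p.1)]|.
Proof.
under eq_bigr => x _ do rewrite -sum1_card.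
by rewrite pair_big_dep -sum1_card; apply: eq_bigl => p; rewrite inE.
Qed.

(** Disjointness of [A] and [L] makes the edge determine the ordered pair, so no edge is counted
    twice. *)
Lemma bipartite_card B (A L : {set 'I_n}) : [disjoint A & L] ->
  \sum_(x in A) #|L :&: neighbours B x| <= #|B|.
Proof.
move=> AL; rewrite sum_card_pairs.
rewrite -(@card_in_imset _ _ (fun p => [set p.1; p.2])).
  apply/subset_leq_card/subsetP=> e /imsetP[[x u]].
  by rewrite !inE /= => /and3P[_ _ xuB] ->.
move=> [x u] [y w]; rewrite !inE /= => /and3P[xA uL _] /and3P[yA wL _] E.
have xw : x != w by apply: contraTneq wL => <-; rewrite (disjointFr AL).
have xy : x = y.
  have : x \in [set y; w] by rewrite -E set21.
  by rewrite !inE (negPf xw) orbF => /eqP.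
by rewrite xy in E *; rewrite (set2_inj E).
Qed.

(** Handshake bound: a set comes from at most two ordered pairs. It is an inequality because [B] may
    contain sets that are not edges. *)
Lemma sum_degree B : \sum_v degree B v <= 2 * #|B|.
Proof.
under eq_bigl => v do rewrite -[true](in_setT v).
rewrite sum_card_pairs mulnC -sum_nat_const.
rewrite -sum1_card (partition_big (fun p => [set p.1; p.2]) (mem B)) /=; last first.
  by move=> [x u]; rewrite !inE.
apply: leq_sum => e eB; rewrite sum1_card.
have [p0 p0P|p0] := pickP [pred p : 'I_n * 'I_n | [set p.1; p.2] == e]; last first.
  rewrite (eq_card0 (A := [pred p | _])) // => p; rewrite !inE /=.
  by have := p0 p; rewrite /= => ->; rewrite andbF.
apply: leq_trans (_ : #|[set p0; (p0.2, p0.1)]| <= 2); last first.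
  by rewrite cards2; case: (_ != _).
apply/subset_leq_card/subsetP=> -[x u]; rewrite !inE /= => /andP[_ /eqP xuE].
move: p0P; rewrite /= -xuE; case: p0 => y w /= /eqP E.
have : y \in [set x; u] by rewrite -E set21.
rewrite !xpair_eqE !inE => /orP[]/eqP yx; subst.
  by rewrite (set2_inj E) !eqxx.
by rewrite [RHS]setUC in E; rewrite (set2_inj E) !eqxx orbT.
Qed.

(** Markov's inequality for the degree sum. *)
Lemma card_high_degree B k : k * #|[set v | k < degree B v]| <= 2 * #|B|.
Proof.
apply: leq_trans (sum_degree B); rewrite mulnC -sum_nat_const.
rewrite [X in _ <= X](bigID (mem [set v | k < degree B v])) /=.
apply: leq_trans (leq_addr _ _); apply: leq_sum => v.
by rewrite inE => /ltnW.
Qed.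

End Degrees.

(** * Maker's growing star *)

Section MakerTriangle.
Variable n : nat.
Implicit Types (M B S G : graph n) (x y z v c : 'I_n) (L : {set 'I_n}).

Lemma maker_closes_triangle b M B v x u :
  [set v; x] \in M -> [set v; u] \in M -> v != x -> v != u -> x != u ->
  [set x; u] \notin B -> maker_wins b (@has_triangle n) Maker M B.
Proof.
move=> vxM vuM vx vu xu xuB.
apply: (@maker_wins_claim _ _ _ _ _ [set x; u]); rewrite ?in_complete //.
  exact: has_triangle_mono.
apply: maker_wins_now; first exact: has_triangle_mono.
exists x, u, v; rewrite /adj xu vx eq_sym vu !in_setU1 eqxx.
by rewrite [[set u; v]]setUC vuM vxM !orbT.
Qed.

(* Once Maker has a star at [v] with leaf set [L], each new leaf [x] is chosen so
   that some [[set x; u]], [u \in L], is free.  Breaker must answer with a star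
   centred at [x] or [u], so that he never claims another edge at [v]. *)
Lemma maker_wins_triangle_star b M B v L : 6 * b + 4 <= n ->
  0 < #|L| <= (2 * b).+1 -> v \notin L -> (forall x, x \in L -> [set v; x] \in M) ->
  #|B| <= #|L|.+1 * b -> degree B v <= 2 * b ->
  maker_wins b (@has_triangle n) Maker M B.
Proof.
move=> n_big; have [k] := ubnP ((2 * b).+1 - #|L|).
elim: k => // k IHk in M B L * => lt_k /andP[L0 Lb] vL vLM cardB degv.
pose A := [set x | [&& x \notin L, x != v & [set v; x] \notin B]].
(* At most [2 * b + 1] leaves, the vertex [v] and [2 * b] Breaker neighbours are excluded; hence the
   bound [6 * b + 4]. *)
have cardA : 2 * b + 2 <= #|A|.
  have : #|[set: 'I_n]| <= #|A :|: L :|: [set v] :|: neighbours B v|.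
    apply/subset_leq_card/subsetP=> x _; rewrite !inE.
    by case: (x \in L); case: (x == v); case: ([set v; x] \in B); rewrite ?orbT.
  rewrite cardsT card_ord => le_n.
  have := (leq_card_setU (A :|: L :|: [set v]) (neighbours B v)).1.
  have := (leq_card_setU (A :|: L) [set v]).1; have := (leq_card_setU A L).1.
  by rewrite cards1; move: degv; rewrite /degree; card_lia.
(* More than [t] threats are wanted: one suffices while the star grows, but more than [b] are needed
   at full size. *)
pose t := if #|L| == (2 * b).+1 then b else 0.
have [x /andP[xA t_lt]] : exists x, (x \in A) && (t < #|L :\: neighbours B x|).
  apply/existsP; apply: contraT; rewrite negb_exists => /forallP none.
  have AL : [disjoint A & L].
    rewrite disjoints_subset; apply/subsetP=> x; rewrite !inE.
    by case/and3P.
  (* Averaging: otherwise [B] would contain at least [#|A| * (#|L| - t)] edges between [A] and [L],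
     more than [#|L|.+1 * b]. *)
  have := leq_trans (bipartite_card B AL) cardB.
  have : \sum_(x in A) (#|L| - t) <= \sum_(x in A) #|L :&: neighbours B x|.
    apply: leq_sum => x xA; have := none x; rewrite xA /= -leqNgt.
    by have := cardsID (neighbours B x) L; card_lia.
  by rewrite sum_nat_const /t; case: eqP => [->|_]; card_nia.
have n_gt0 : 0 < n by card_lia.
move: xA; rewrite inE => /and3P[xL xv vxB].
apply: (@maker_wins_claim _ _ _ _ _ [set v; x]); rewrite ?in_complete 1?eq_sym //.
  exact: has_triangle_mono.
set M' := [set v; x] |: M.
have vLM' u : u \in x |: L -> [set v; u] \in M'.
  by rewrite !inE => /orP[/eqP->|/vLM ->]; rewrite ?eqxx ?orbT.
apply: maker_wins_reply => //; first exact: has_triangle_mono.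
move=> S [SU cardS [c cS]].
have [/forallP all_blocked|] :=
    boolP [forall u, (u \in L :\: neighbours B x) ==> ([set x; u] \in S)]; last first.
  rewrite negb_forall => /existsP[u]; rewrite negb_imply !inE.
  case/andP=> /andP[xuB uL] xuS.
  apply: (@maker_closes_triangle _ _ _ v x u); rewrite ?vLM' ?inE ?eqxx ?uL ?orbT //.
  - by rewrite eq_sym.
  - by apply: contraNneq vL => ->.
  - by apply: contraNneq xL => ->.
  - by rewrite negb_or xuB.
have blocked u : u \in L :\: neighbours B x -> [set x; u] \in S.
  by move=> uL; have := all_blocked u; rewrite uL.
(* Blocking costs one edge of [S] per threat, so more than [b] threats cannot all be blocked. *)
have t_small : #|L| < (2 * b).+1.
  rewrite ltn_neqAle Lb andbT; apply/negP => Lfull.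
  have : #|L :\: neighbours B x| <= b.
    apply: leq_trans cardS; rewrite -(card_imset _ (@set2_inj _ x)).
    by apply/subset_leq_card/subsetP=> e /imsetP[u /blocked uS ->].
  by move: t_lt; rewrite /t Lfull; card_lia.
have /card_gt0P[u uL'] : 0 < #|L :\: neighbours B x| by apply: leq_ltn_trans t_lt.
have uL : u \in L by move: uL'; rewrite inE => /andP[].
(* [S] contains some [[set x; u]], so its centre is a leaf, and the edge from that leaf to [v] is
   already Maker's. *)
have degS : degree S v = 0.
  apply/eqP; rewrite cards_eq0; apply/eqP/setP=> z; rewrite !inE.
  apply/negP=> vzS.
  have zc : z = c.
    have := cS _ (blocked u uL'); have := cS _ vzS; rewrite !inE.
    case/orP=> /eqP-> //; rewrite [v == x]eq_sym (negPf xv) /= => /eqP vu.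
    by rewrite vu uL in vL.
  have := subsetP SU _ vzS; rewrite in_unclaimed vLM' //.
  have := cS _ (blocked u uL'); rewrite !inE zc => /orP[]/eqP ->; rewrite ?eqxx //.
  by rewrite uL orbT.
apply: (IHk _ _ (x |: L)) => //; rewrite ?cardsU1 ?xL /= ?add1n; try card_lia.
- by rewrite in_setU1 negb_or eq_sym xv.
- apply: leq_trans (leq_card_setU _ _) _; rewrite [_.+2 * b]mulSn; card_lia.
- by apply: leq_trans (degreeU _ _ _) _; rewrite degS addn0.
Qed.

(** Breaker moves twice before Maker extends her one-leaf star. His [2 * b] edges match
    [#|L|.+1 * b] and also bound his degree at [v]. *)
Lemma maker_wins_triangle b p : 6 * b + 4 <= n ->
  maker_wins b (@has_triangle n) p set0 set0.
Proof.
move=> n_big; have n_gt1 : 1 < n by card_lia.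
have mono := @has_triangle_mono n.
apply: maker_wins_first => //; apply: maker_wins_reply => //; last by card_lia.
move=> S [_ cardS _]; rewrite set0U.
pose v := Ordinal (ltnW n_gt1).
have [x xv vxS] : exists2 x, x != v & [set v; x] \notin S.
  have : 0 < #|~: (v |: neighbours S v)|.
    have := cardsC (v |: neighbours S v); rewrite card_ord.
    have := (leq_card_setU [set v] (neighbours S v)).1; rewrite cards1.
    have := degree_leq_card S v; rewrite /degree; card_lia.
  by case/card_gt0P=> x; rewrite !inE negb_or => /andP[]; exists x.
apply: (@maker_wins_claim _ _ _ _ _ [set v; x]); rewrite ?in_complete 1?eq_sym //.
apply: maker_wins_reply => //; last by card_lia.
move=> S' [_ cardS' _]; have cardSS := (leq_card_setU S S').1.
apply: (@maker_wins_triangle_star _ _ _ v [set x]); rewrite ?cards1 ?inE 1?eq_sym //.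
- by move=> z; rewrite !inE => /eqP->; rewrite eqxx.
- by card_lia.
- by apply: leq_trans (degree_leq_card _ _) _; card_lia.
Qed.

End MakerTriangle.

(** * The Hamiltonicity game *)

Section CyclicSequences.
Variables (T : finType) (x0 : T).
Implicit Types (s t X Y Z : seq T) (a : pred {set T}).

Definition path_edges s : seq {set T} :=
  if s is x :: t then pairmap (fun y z => [set y; z]) x t else [::].

(** A list, so that [count] splits over arcs. The closing edge comes first, and [x0] matters only
    for the empty sequence. *)
Definition cycle_edges s : seq {set T} :=
  [set last x0 s; head x0 s] :: path_edges s.

Lemma last_rev s : last x0 (rev s) = head x0 s.
Proof. by case: s => // x s; rewrite rev_cons last_rcons. Qed.

Lemma head_rev s : head x0 (rev s) = last x0 s.
Proof. by rewrite -[s in RHS]revK last_rev. Qed.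

Lemma last_catr s t : t != [::] -> last x0 (s ++ t) = last x0 t.
Proof. by case: t => // x t _; rewrite last_cat. Qed.

Lemma head_catl s t : s != [::] -> head x0 (s ++ t) = head x0 s.
Proof. by case: s. Qed.

Lemma path_edges_cat X Z : X != [::] -> Z != [::] ->
  path_edges (X ++ Z) =
  path_edges X ++ [set last x0 X; head x0 Z] :: path_edges Z.
Proof. by case: X => // x X; case: Z => // z Z _ _; rewrite /= pairmap_cat. Qed.

Lemma rev_eq_nil s : (rev s == [::]) = (s == [::]).
Proof. by rewrite -!size_eq0 size_rev. Qed.

Lemma cat_eq_nil s t : (s ++ t == [::]) = (s == [::]) && (t == [::]).
Proof. by case: s. Qed.

Lemma count_path_edges_rev a s : count a (path_edges (rev s)) = count a (path_edges s).
Proof.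
elim: s => // x s IHs; rewrite rev_cons -cats1.
have [->//|s0] := eqVneq s [::].
rewrite path_edges_cat ?rev_eq_nil // count_cat IHs /= addn0 last_rev setUC.
by case: s s0 {IHs} => //= y s _; rewrite addnC.
Qed.

Lemma count_cycle_edges2 a X Z : X != [::] -> Z != [::] ->
  count a (cycle_edges (X ++ Z)) =
  a [set last x0 X; head x0 Z] + a [set last x0 Z; head x0 X] +
  count a (path_edges X) + count a (path_edges Z).
Proof.
move=> X0 Z0; rewrite /= last_catr // head_catl // path_edges_cat // count_cat /=.
by lia.
Qed.

(** Rearranging or reversing arcs changes only the three junction terms, which reduces both
    exchanges in [merge_threats] to arithmetic. *)
Lemma count_cycle_edges3 a X Y Z : X != [::] -> Y != [::] -> Z != [::] ->
  count a (cycle_edges (X ++ Y ++ Z)) =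
  a [set last x0 X; head x0 Y] + a [set last x0 Y; head x0 Z] +
  a [set last x0 Z; head x0 X] +
  count a (path_edges X) + count a (path_edges Y) + count a (path_edges Z).
Proof.
move=> X0 Y0 Z0; have YZ0 : Y ++ Z != [::] by rewrite cat_eq_nil (negPf Y0).
rewrite count_cycle_edges2 // last_catr // head_catl // path_edges_cat // count_cat /=.
by lia.
Qed.

Lemma count_cycle_edges_rev a s :
  count a (cycle_edges (rev s)) = count a (cycle_edges s).
Proof. by rewrite /= count_path_edges_rev last_rev head_rev setUC. Qed.

Lemma path_edges_split e s : e \in path_edges s ->
  exists X Z, [/\ X != [::], Z != [::], s = X ++ Z & e = [set last x0 X; head x0 Z]].
Proof.
elim: s => // x [|y s] // IHs; rewrite inE => /orP[/eqP->|es].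
  by exists [:: x], (y :: s).
have [X [Z [X0 Z0 -> eE]]] := IHs es; exists (x :: X), Z; split=> //.
by rewrite eE; case: X X0 {eE}.
Qed.

Lemma cycle_edges_split e s : e \in cycle_edges s ->
  exists s', [/\ perm_eq s' s, e = [set last x0 s'; head x0 s']
    & forall a, count a (cycle_edges s') = count a (cycle_edges s)].
Proof.
rewrite inE => /orP[/eqP eE|/path_edges_split[X [Z [X0 Z0 -> eE]]]]; first by exists s.
exists (Z ++ X); split; first by rewrite perm_catC.
  by rewrite last_catr ?head_catl.
by move=> a; rewrite !count_cycle_edges2 //; lia.
Qed.

(** Rotation makes the chosen edge the closing one, and reversal puts [p] last if necessary. *)
Lemma cycle_edges_split_at e s p : e \in cycle_edges s -> p \in e ->
  exists s', [/\ perm_eq s' s, last x0 s' = p, e = [set p; head x0 s']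
    & forall a, count a (cycle_edges s') = count a (cycle_edges s)].
Proof.
case/cycle_edges_split=> s' [s's eE ce]; rewrite eE !inE => /orP[]/eqP pE.
  by exists s'; rewrite -pE.
exists (rev s'); rewrite last_rev head_rev setUC -pE; split=> // [|a].
  by rewrite perm_rev.
by rewrite count_cycle_edges_rev.
Qed.

Lemma count_cycle_edges_vertex s v : uniq s ->
  count (fun e : {set T} => v \in e) (cycle_edges s) <= 2.
Proof.
have bound x t : count (fun e : {set T} => v \in e) (pairmap (fun y z : T => [set y; z]) x t) <=
    count_mem v (belast x t) + count_mem v t.
  elim: t x => //= y t IHt x; have := IHt y; rewrite !inE [v == x]eq_sym [v == y]eq_sym.
  by case: (x == v); case: (y == v) => /=; lia.
case: s => [|x t] s_uniq.
  by rewrite /=; case: (v \in _).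
have c1 : count_mem v (x :: t) <= 1.
  by rewrite (count_uniq_mem _ s_uniq); case: (_ \in _).
have c2 : count_mem v (belast x t) + (last x t == v) <= 1.
  by move: c1; rewrite lastI -cats1 count_cat /= addn0.
move: c1 c2 (bound x t); rewrite /= !inE [v == last x t]eq_sym [v == x]eq_sym.
by case: (x == v); case: (last x t == v); rewrite /=; lia.
Qed.

Lemma card_nth_mem s (P : {set T}) i m : uniq s -> i + m <= size s ->
  #|[set j : 'I_m | nth x0 s (i + j) \in P]| <= #|P|.
Proof.
move=> s_uniq le_im.
rewrite -(@card_in_imset _ _ (fun j : 'I_m => nth x0 s (i + j))).
  by apply/subset_leq_card/subsetP=> x /imsetP[j]; rewrite inE => jP ->.
have lt_s (j : 'I_m) : i + j < size s.
  by apply: leq_trans le_im; rewrite ltn_add2l.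
move=> j k _ _ /eqP; rewrite nth_uniq ?lt_s //.
by rewrite eqn_add2l => /eqP/val_inj.
Qed.

(** Union bound over the [m] common shifts of three windows. *)
Lemma exists_nth_notin3 s (P1 P2 P3 : {set T}) i1 i2 i3 m : uniq s ->
  i1 + m <= size s -> i2 + m <= size s -> i3 + m <= size s ->
  #|P1| + #|P2| + #|P3| < m ->
  exists2 j, j < m & [/\ nth x0 s (i1 + j) \notin P1, nth x0 s (i2 + j) \notin P2
    & nth x0 s (i3 + j) \notin P3].
Proof.
move=> s_uniq h1 h2 h3 lt_m.
pose N (P : {set T}) i := [set j : 'I_m | nth x0 s (i + j) \in P].
have : 0 < #|~: (N P1 i1 :|: N P2 i2 :|: N P3 i3)|.
  have := cardsC (N P1 i1 :|: N P2 i2 :|: N P3 i3); rewrite card_ord.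
  have := (leq_card_setU (N P1 i1 :|: N P2 i2) (N P3 i3)).1.
  have := (leq_card_setU (N P1 i1) (N P2 i2)).1.
  have := card_nth_mem P1 s_uniq h1; have := card_nth_mem P2 s_uniq h2.
  have := card_nth_mem P3 s_uniq h3; rewrite -!/(N _ _).
  by card_lia.
case/card_gt0P=> j; rewrite !inE !negb_or => /andP[/andP[j1 j2] j3].
by exists j.
Qed.

End CyclicSequences.

(** * Gaps of a cyclic ordering and their removal *)

Section Gaps.
Variables (n : nat) (x0 : 'I_n).
Implicit Types (M B : graph n) (s : seq 'I_n) (p v w y z : 'I_n).

Definition num_gaps M s := count (fun e => e \notin M) (cycle_edges x0 s).

Definition gaps_at M s v :=
  count (fun e => (e \notin M) && (v \in e)) (cycle_edges x0 s).

Lemma gaps_at_leq2 M s v : uniq s -> gaps_at M s v <= 2.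
Proof.
move=> s_uniq; apply: leq_trans (count_cycle_edges_vertex x0 v s_uniq).
by apply: sub_count => e /= /andP[].
Qed.

Lemma gaps_at_gt0 M s e v : e \in cycle_edges x0 s -> e \notin M -> v \in e ->
  0 < gaps_at M s v.
Proof. by move=> es eM ve; rewrite -has_count; apply/hasP; exists e; rewrite ?eM. Qed.

Lemma num_gaps_leq M s : s != [::] -> num_gaps M s <= size s.
Proof.
by case: s => // x t _; apply: leq_trans (count_size _ _) _; rewrite /= size_pairmap.
Qed.

Lemma sub_count_notin M M' (q : pred {set 'I_n}) (r : seq {set 'I_n}) : M \subset M' ->
  count (fun e => (e \notin M') && q e) r <= count (fun e => (e \notin M) && q e) r.
Proof.
move=> /subsetP MM'; apply: sub_count => e /andP[eM' qe]; rewrite /= qe andbT.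
by apply: contraNN eM'; apply: MM'.
Qed.

(** In this form one inequality, stated for every predicate [q], covers [num_gaps] and all
    [gaps_at]. *)
Lemma num_gapsE M s :
  num_gaps M s = count (fun e => (e \notin M) && true) (cycle_edges x0 s).
Proof. by apply: eq_count => e; rewrite andbT. Qed.

Lemma sorted_path_edges M s : uniq s -> all (mem M) (path_edges s) -> sorted (adj M) s.
Proof.
case: s => // x t; elim: t x => //= y t IHt x.
case/andP=> xyt yt_uniq /andP[xyM yt_M]; rewrite IHt // andbT /adj xyM andbT.
by apply: contraNneq xyt => ->; rewrite mem_head.
Qed.

Lemma hamiltonian_of_gaps M s : perm_eq s (enum 'I_n) -> num_gaps M s <= 1 ->
  has_hamiltonian_path M.
Proof.
move=> s_enum gaps.
(* The gap, if there is one, is rotated to the closing edge, which the path omits. *)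
have [s' [s's gaps']] : exists s', perm_eq s' s /\ ~~ has (fun e => e \notin M) (path_edges s').
  have [gs|ngs] := boolP (has (fun e => e \notin M) (cycle_edges x0 s)); last first.
    exists s; split=> //; apply: contraNN ngs => gs.
    by rewrite /cycle_edges /= gs orbT.
  have [e es eM] := hasP gs; have [s' [s's eE ces]] := cycle_edges_split es.
  exists s'; split=> //; rewrite has_count -leqNgt.
  by move: gaps; rewrite /num_gaps -ces /= -eE eM.
have s'_enum := perm_trans s's s_enum.
have s'_uniq : uniq s' by rewrite (perm_uniq s'_enum) enum_uniq.
exists s'; split=> //.
  by move=> x; rewrite (perm_mem s'_enum) mem_enum.
apply: sorted_path_edges => //; apply/allP=> e es'; apply: contraNT gaps' => eM.
by apply/hasP; exists e.
Qed.

(* A 2-opt move: the gap [[set p; y]] and the edge [[set w; z]] of the cycle are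
   exchanged for the new Maker edge [[set p; w]] and the gap [[set y; z]]. *)
Lemma rotate_gap M B s p d : perm_eq s (enum 'I_n) -> 0 < gaps_at M s p ->
  d < degree B p -> degree B p + #|[set v | d < degree B v]| < n.-1 ->
  exists w z s', let M' := [set p; w] |: M in
    [/\ [/\ perm_eq s' (enum 'I_n), p != w & [set p; w] \notin B],
        [/\ degree B z <= d, gaps_at M' s' p < gaps_at M s p
          & num_gaps M' s' <= num_gaps M s]
      & forall v, v != z -> gaps_at M' s' v <= gaps_at M s v].
Proof.
move=> s_enum; rewrite -has_count => /hasP[e es /andP[eM pe]] deg_p few.
have [s1 [s1s last_s1 eE ces]] := cycle_edges_split_at es pe.
have s1_enum := perm_trans s1s s_enum.
have s1_uniq : uniq s1 by rewrite (perm_uniq s1_enum) enum_uniq.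
have s1_size : size s1 = n by rewrite (perm_size s1_enum) size_enum_ord.
(* [w] must not be a Breaker neighbour of [p], and its successor [z] must have small degree; the
   third set is empty. A last position has no successor, hence [n.-1]. *)
have [j lt_j] : exists2 j, j < n.-1 & [/\ nth x0 s1 (0 + j) \notin neighbours B p,
    nth x0 s1 (1 + j) \notin [set v | d < degree B v] & nth x0 s1 (0 + j) \notin set0].
  by apply: exists_nth_notin3 => //; rewrite ?cards0 ?addn0 ?s1_size //;
    move: few (ltn_ord p); clear; card_lia.
rewrite add0n add1n => -[pw dz _].
have lt_jn : j.+1 < n by move: lt_j; clear; card_lia.
set w := nth x0 s1 j in pw; set z := nth x0 s1 j.+1 in dz.
set y := head x0 s1 in eE.
pose X := take j.+1 s1; pose Z := drop j.+1 s1.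
have sXZ : s1 = X ++ Z by rewrite cat_take_drop.
have X0 : X != [::] by rewrite -size_eq0 size_takel // s1_size ltnW.
have Z0 : Z != [::] by rewrite -size_eq0 size_drop s1_size subn_eq0 -ltnNge.
have lastX : last x0 X = w by rewrite -nth_last size_takel ?nth_take // s1_size ltnW.
have headZ : head x0 Z = z by rewrite -nth0 nth_drop addn0.
have headX : head x0 X = y by rewrite /y sXZ head_catl.
have lastZ : last x0 Z = p by rewrite -last_s1 sXZ last_catr.
have py : p != y.
  by rewrite -last_s1 -nth_last /y -nth0 nth_uniq ?s1_size //; move: lt_jn; clear; card_lia.
have p_w : p != w.
  by rewrite -last_s1 -nth_last /w nth_uniq ?s1_size //; move: lt_jn; clear; card_lia.
have p_z : p != z by apply: contraNneq dz => <-; rewrite inE.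
exists w, z, (rev X ++ Z) => M'.
have MM' : M \subset M' by apply: subsetUr.
have rX0 : rev X != [::] by rewrite rev_eq_nil.
have pwM' : [set p; w] \in M' by rewrite setU11.
have pyM : [set p; y] \notin M by rewrite -eE.
(* The only possible new gap [[set y; z]] replaces [[set p; y]], so [y] loses one gap and gains at
   most one. Membership of [p], truth and membership of [v] are the instances of [q] used below. *)
have cE (q : pred {set 'I_n}) :
    count (fun f => (f \notin M') && q f) (cycle_edges x0 (rev X ++ Z)) + q [set p; y] <=
    count (fun f => (f \notin M) && q f) (cycle_edges x0 s) + q [set y; z].
  rewrite -ces [in X in _ <= X]sXZ !count_cycle_edges2 // (count_path_edges_rev x0).
  rewrite last_rev head_rev lastX headX headZ lastZ pwM' pyM /=.
  have := sub_count_notin q (path_edges X) MM'; have := sub_count_notin q (path_edges Z) MM'.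
  by clear; card_norm; case: (q [set y; z]); case: ([set y; z] \notin M') => /=; lia.
split.
- split=> //; last by move: pw; rewrite inE.
  apply: perm_trans s1_enum; rewrite sXZ perm_cat2r; exact/permPl/perm_rev.
- split; first by move: dz; rewrite inE -leqNgt.
    have := cE (fun f => p \in f); rewrite -/(gaps_at M s p) -/(gaps_at M' _ p).
    by rewrite !inE eqxx (negPf py) (negPf p_z) /=; clear; card_lia.
  by rewrite !num_gapsE; have := cE predT; rewrite /=; clear; card_lia.
- move=> v vz; have := cE (fun f => v \in f).
  rewrite -/(gaps_at M s v) -/(gaps_at M' _ v) !inE (negPf vz) orbF.
  by clear; card_norm; case: (v == y); rewrite ?orbT /=; lia.
Qed.

(** The cycle is rotated so that one gap closes it, then cut at another. [Q] is the longer arc,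
    leaving room to choose a vertex inside it. *)
Lemma two_gaps_split M s : 1 < num_gaps M s ->
  exists D Q, [/\ perm_eq (D ++ Q) s,
    forall a, count a (cycle_edges x0 (D ++ Q)) = count a (cycle_edges x0 s),
    [/\ D != [::], Q != [::] & size D <= size Q]
    & [set last x0 D; head x0 Q] \notin M /\ [set last x0 Q; head x0 D] \notin M].
Proof.
move=> gs; have /hasP[e es eM] : has (fun e => e \notin M) (cycle_edges x0 s).
  by rewrite has_count; apply: ltnW.
have [s1 [s1s eE ces]] := cycle_edges_split es.
have /hasP[f fs fM] : has (fun e => e \notin M) (path_edges s1).
  by rewrite has_count; move: gs; rewrite /num_gaps -ces /= -eE eM; clear; card_lia.
have [X [Z [X0 Z0 sXZ fE]]] := path_edges_split x0 fs.
rewrite sXZ last_catr // head_catl // in eE.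
have [XZ|ZX] := leqP (size X) (size Z).
  by exists X, Z; rewrite -fE -eE -sXZ.
exists Z, X; rewrite -fE -eE; split=> //; last by split=> //; apply: ltnW.
  by rewrite perm_catC -sXZ.
by move=> a; rewrite -ces sXZ !count_cycle_edges2 //; clear; card_lia.
Qed.

(* Joining [p], an end of the arc [D], to an inner vertex [w] of the arc [Q]
   leaves two disjoint edges each of which removes a gap: reversing the part of
   [Q] up to [w], or exchanging the two parts of [Q] around [w]. *)
Lemma merge_threats M B D Q d : perm_eq (D ++ Q) (enum 'I_n) ->
  [/\ D != [::], Q != [::] & 3 * d + 5 <= size Q] ->
  [set last x0 D; head x0 Q] \notin M -> [set last x0 Q; head x0 D] \notin M ->
  [/\ degree B (last x0 D) <= d, degree B (head x0 Q) <= d & degree B (last x0 Q) <= d] ->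
  exists w e1 e2,
    [/\ last x0 D != w, [set last x0 D; w] \notin B,
      [/\ e1 \in complete_graph n, e2 \in complete_graph n, e1 \notin B, e2 \notin B
        & [disjoint e1 & e2]]
    & forall M', M \subset M' -> [set last x0 D; w] \in M' -> e1 \in M' \/ e2 \in M' ->
      exists s', [/\ perm_eq s' (enum 'I_n), num_gaps M' s' < num_gaps M (D ++ Q)
        & forall v, gaps_at M' s' v <= gaps_at M (D ++ Q) v]].
Proof.
move=> DQ_enum [D0 Q0 Q_size]; set p := last x0 D; set y := head x0 Q; set p2 := last x0 Q.
set y2 := head x0 D => pyM p2y2M [deg_p deg_y deg_p2].
have DQ_uniq : uniq (D ++ Q) by rewrite (perm_uniq DQ_enum) enum_uniq.
have Q_uniq : uniq Q by move: DQ_uniq; rewrite cat_uniq => /and3P[].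
(* The consecutive vertices [u], [w], [z] avoid both ends of [Q]; each condition excludes at most
   [d] of the more than [3 * d] positions. *)
have [j lt_j [w1 w2 w3]] : exists2 j, j < size Q - 4 &
    [/\ nth x0 Q (1 + j) \notin neighbours B p2,
    nth x0 Q (2 + j) \notin neighbours B p & nth x0 Q (3 + j) \notin neighbours B y].
  by apply: exists_nth_notin3 => //;
    move: deg_p deg_y deg_p2 Q_size; rewrite /degree; clear; card_lia.
move: w1 w2 w3; rewrite !inE.
have lt_jQ : 4 + j < size Q by move: lt_j; clear; card_lia.
set u := nth x0 Q (1 + j); set w := nth x0 Q (2 + j); set z := nth x0 Q (3 + j) => uB wB zB.
pose Q1 := take (2 + j) Q; pose Q2 := drop (3 + j) Q.
have QE : Q = Q1 ++ w :: Q2.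
  by rewrite /w -drop_nth ?cat_take_drop //; move: lt_jQ; clear; card_lia.
have Q10 : Q1 != [::] by rewrite -size_eq0 size_takel; move: lt_jQ; clear; card_lia.
have Q20 : Q2 != [::] by rewrite -size_eq0 size_drop; move: lt_jQ; clear; card_lia.
have lastQ1 : last x0 Q1 = u.
  by rewrite -nth_last size_takel ?nth_take //; move: lt_jQ; clear; card_lia.
have headQ2 : head x0 Q2 = z by rewrite -nth0 nth_drop addn0.
have headQ1 : head x0 Q1 = y by rewrite /y QE head_catl.
have lastQ2 : last x0 Q2 = p2 by rewrite /p2 QE -cat_rcons last_catr.
have yE : y = nth x0 Q 0 by rewrite nth0.
have p2E : p2 = nth x0 Q (size Q).-1 by rewrite nth_last.
have pw : p != w.
  have wD : w \notin D.
    move: DQ_uniq; rewrite cat_uniq => /and3P[_ /hasPn/(_ w) wD _]; apply: wD.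
    by rewrite mem_nth //; move: lt_jQ; clear; card_lia.
  by apply: contraNneq wD => <-; rewrite /p; case: (D) D0 => // x D' _; rewrite /= mem_last.
exists w, [set y; z], [set p2; u]; split=> //.
  split=> //.
  - by rewrite in_complete yE nth_uniq //; move: lt_jQ; clear; card_lia.
  - by rewrite in_complete p2E nth_uniq //; move: lt_jQ; clear; card_lia.
  - rewrite disjoints_subset; apply/subsetP=> v; rewrite !inE negb_or.
    by case/orP=> /eqP->; rewrite ?yE ?p2E !nth_uniq //; move: lt_jQ; clear; card_lia.
move=> M' MM' pwM' e12.
have le_c (q : pred {set 'I_n}) (r : seq {set 'I_n}) :
    count (fun f => (f \notin M') && q f) r <= count (fun f => (f \notin M) && q f) r.
  exact: sub_count_notin.
have le_1 (q : pred {set 'I_n}) (e : {set 'I_n}) : (e \notin M') && q e <= (e \notin M) && q e.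
  by have := le_c q [:: e]; rewrite /= !addn0.
case: e12 => eM'.
(* The junctions are [[set p; w]], [[set y; z]] and the old [[set p2; y2]]; the gap [[set p; y]] is
   gone. *)
- pose s' := D ++ rev (rcons Q1 w) ++ Q2.
  have cE (q : pred {set 'I_n}) :
      count (fun f => (f \notin M') && q f) (cycle_edges x0 s') + q [set p; y] <=
      count (fun f => (f \notin M) && q f) (cycle_edges x0 (D ++ Q)).
    have r0 : rcons Q1 w != [::] by case: (Q1).
    have h0 : head x0 (rcons Q1 w) = y by rewrite -headQ1; case: (Q1) Q10.
    rewrite /s' [in X in _ <= X]QE -cat_rcons !count_cycle_edges3 ?rev_eq_nil //.
    rewrite (count_path_edges_rev x0) last_rev head_rev last_rcons h0 headQ2 lastQ2.
    rewrite -/p -/y2 pwM' eM' pyM /=.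
    have := le_c q (path_edges D); have := le_c q (path_edges (rcons Q1 w)).
    have := le_c q (path_edges Q2); have := le_1 q [set p2; y2].
    by clear; card_lia.
  exists s'; split.
  + apply: perm_trans DQ_enum; rewrite perm_cat2l [X in perm_eq _ X]QE -cat_rcons perm_cat2r.
    exact/permPl/perm_rev.
  + by rewrite !num_gapsE; have := cE predT; rewrite /=; clear; card_lia.
  + by move=> v; have := cE (fun f => v \in f); rewrite /gaps_at; clear; card_lia.
(* The junctions are [[set p; w]], [[set p2; u]] and [[set y; y2]]: two gaps become at most one,
   between vertices that each lost a gap. *)
- pose s' := D ++ (w :: Q2) ++ rev Q1.
  have cE (q : pred {set 'I_n}) :
      count (fun f => (f \notin M') && q f) (cycle_edges x0 s') +
        q [set p; y] + q [set p2; y2] <=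
      count (fun f => (f \notin M) && q f) (cycle_edges x0 (D ++ Q)) + q [set y; y2].
    rewrite /s' [in X in _ <= X]QE !count_cycle_edges3 ?rev_eq_nil //.
    rewrite (count_path_edges_rev x0) last_rev head_rev lastQ1 headQ1.
    have -> : last x0 (w :: Q2) = p2 by rewrite -lastQ2; case: (Q2) Q20.
    rewrite -/p -/y2 [head x0 (w :: Q2)]/= pwM' eM' pyM p2y2M.
    have := le_c q (path_edges D); have := le_c q (path_edges Q1).
    have := le_c q (path_edges (w :: Q2)).
    by clear; card_norm; case: (q [set y; y2]); case: ([set y; y2] \notin M'); rewrite /=; lia.
  exists s'; split.
  + apply: perm_trans DQ_enum; rewrite perm_cat2l [X in perm_eq _ X]QE perm_catC perm_cat2r.
    exact/permPl/perm_rev.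
  + by rewrite !num_gapsE; have := cE predT; rewrite /=; clear; card_lia.
  + move=> v; have := cE (fun f => v \in f); rewrite /gaps_at !inE.
    by clear; card_norm; case: (v == y); case: (v == y2);
      case: (v == p); case: (v == p2); rewrite /=; lia.
Qed.

End Gaps.

(** * Maker's strategy: repairs and double threats *)

Section MakerHamiltonian.
Variables (n : nat) (x0 : 'I_n) (b d : nat).
Hypotheses (d_leq_n : 100 * d <= n) (n_leq_d : n <= 200 * d) (b_leq_d : 3300 * b + 10 <= d).
Implicit Types (M B S : graph n) (s : seq 'I_n) (p v w y z c : 'I_n).

Local Notation gaps_at := (gaps_at x0).
Local Notation num_gaps := (num_gaps x0).

(** The tolerated Breaker degree: [d] at a vertex with two gaps, [2 * d] with one, so removing a gap
    buys another [d]. *)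
Definition level M s v := d * (3 - gaps_at M s v).

(* Bounds the number of moves that Maker has spent on vertices in danger: each of
   them removes for good one of the at most two gaps at a vertex of large degree. *)
Definition repairs M B s := \sum_(v | d < degree B v) (2 - gaps_at M s v).

Definition in_danger M B s v := (0 < gaps_at M s v) && (level M s v < degree B v).

(** The position before Breaker's turns. A repair accounts for [b] Breaker edges, a removed gap for
    [2 * b] because it takes two of his turns. After a double threat, [x] is the centre of the star
    answering it; each later repair lets the excess over the level grow by at most one. *)
Definition resting M B s :=
  [/\ perm_eq s (enum 'I_n),
      #|B| + 2 * b * num_gaps M s <= b * (2 * n + repairs M B s)
    & exists x, forall v, 0 < gaps_at M s v ->
        degree B v <= level M s v + repairs M B s + 1 + (v == x) * b].

Lemma repairs_mono M B s M' B' s' : B \subset B' ->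
  (forall v, d < degree B v -> gaps_at M' s' v <= gaps_at M s v) ->
  repairs M B s <= repairs M' B' s'.
Proof.
move=> BB' le_gaps; rewrite /repairs [X in _ <= X](bigID (fun v => d < degree B v)) /=.
apply: leq_trans (leq_addr _ _).
rewrite [X in _ <= X](eq_bigl (fun v => d < degree B v)); last first.
  move=> v; case: (ltnP d (degree B v)) => [dv|_]; last by rewrite andbF.
  by rewrite andbT; apply: leq_trans dv (degree_mono _ BB').
by apply: leq_sum => v dv; apply: leq_sub2l; apply: le_gaps.
Qed.

Lemma repairs_lt M B s M' s' p : uniq s -> d < degree B p ->
  (forall v, d < degree B v -> gaps_at M' s' v <= gaps_at M s v) ->
  gaps_at M' s' p < gaps_at M s p -> repairs M B s < repairs M' B s'.
Proof.
move=> s_uniq dp le_gaps lt_p; rewrite /repairs !(bigD1 p dp) /=.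
rewrite -addSn; apply: leq_add.
  by have := gaps_at_leq2 x0 M p s_uniq; move: lt_p; clear; lia.
by apply: leq_sum => v /andP[dv _]; apply: leq_sub2l; apply: le_gaps.
Qed.

Lemma repairs_leq_card M B s : repairs M B s <= 2 * #|[set v | d < degree B v]|.
Proof.
rewrite mulnC -sum_nat_const; under [X in _ <= X]eq_bigl => v do rewrite inE.
by apply: leq_sum => v _; apply: leq_subr.
Qed.

Lemma repairs_leq M B s : repairs M B s <= 2 * n.
Proof.
apply: leq_trans (repairs_leq_card M B s) _; rewrite leq_mul2l /=.
by apply: leq_trans (max_card _) _; rewrite card_ord.
Qed.

Lemma resting_card M B s : resting M B s -> #|B| <= 4 * b * n.
Proof.
case=> _ cardB _; have := repairs_leq M B s; move: cardB; clear; card_norm; nia.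
Qed.

(** Twice the number of edges is at most [8 * b * n + 2 * b]; [n <= 200 * d] bounds the first term
    by [1600 * b * d], and the second is at most [2 * b * d]. *)
Lemma card_high_leq B : #|B| <= 4 * b * n + b -> #|[set v | d < degree B v]| <= 1602 * b.
Proof.
have := card_high_degree B d; set h := #|[set v | _]|; move: (#|B|) h => cB h.
move: d_leq_n n_leq_d b_leq_d; clear => *.
have : d * h <= d * (1602 * b) by nia.
by rewrite leq_mul2l; case/orP=> // /eqP; lia.
Qed.

Lemma resting_repairs M B s : resting M B s -> repairs M B s <= 3204 * b.
Proof.
move=> rest; apply: leq_trans (repairs_leq_card M B s) _.
have := @card_high_leq B (leq_trans (resting_card rest) (leq_addr _ _)).
by clear; card_lia.
Qed.

Lemma degree_breaker_move B S c v : #|S| <= b -> (forall e, e \in S -> c \in e) ->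
  degree (B :|: S) v <= degree B v + (if v == c then b else 1).
Proof.
move=> cardS cS; apply: leq_trans (degreeU _ _ _) _; rewrite leq_add2l.
case: eqVneq => [->|vc]; first exact: leq_trans (degree_leq_card _ _) cardS.
exact: degree_star cS vc.
Qed.

Lemma level_leq M s v : 0 < gaps_at M s v -> level M s v <= 2 * d.
Proof. by rewrite /level; move: (gaps_at M s v) => k; clear; nia. Qed.

Lemma level_mono M s M' s' v : gaps_at M' s' v <= gaps_at M s v ->
  level M s v <= level M' s' v.
Proof. by move=> le_k; rewrite leq_mul2l leq_sub2l ?orbT. Qed.

(** If the centre [c] is in danger, it is the vertex repaired; every other endangered vertex has
    gained at most one, which the increase of [repairs] pays for. Only [z] can gain a gap, and its
    degree is within any level. *)
Lemma repair_danger M B S s p c : resting M B s ->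
  #|S| <= b -> (forall e, e \in S -> c \in e) ->
  in_danger M (B :|: S) s p -> (in_danger M (B :|: S) s c -> p = c) ->
  exists w s', let M' := [set p; w] |: M in
    [/\ p != w, [set p; w] \notin B :|: S, resting M' (B :|: S) s',
        num_gaps M' s' <= num_gaps M s & repairs M B s < repairs M' (B :|: S) s'].
Proof.
move=> rest cardS cS /andP[p_gap p_deg] p_c.
have rep := resting_repairs rest.
have cardB := resting_card rest.
case: rest => s_enum budget [x bound]; set B' := B :|: S in p_deg p_c *.
have s_uniq : uniq s by rewrite (perm_uniq s_enum) enum_uniq.
have BB' : B \subset B' by apply: subsetUl.
have cardB' : #|B'| <= #|B| + b.
  by apply: leq_trans (leq_card_setU _ _) _; rewrite leq_add2l.
have high : #|[set v | d < degree B' v]| <= 1602 * b.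
  by apply: card_high_leq; apply: leq_trans cardB' _; rewrite leq_add2r.
have degB' v := degree_breaker_move B v cardS cS.
have bound' v : 0 < gaps_at M s v -> degree B' v <= level M s v + 3206 * b + 2.
  move=> /bound; have := degB' v; move: rep; rewrite -/B'.
  by clear; case: (v == x); case: (v == c); lia.
have d_gt : d < degree B' p.
  apply: leq_trans p_deg; rewrite ltnS /level leq_pmulr //.
  by have := gaps_at_leq2 x0 M p s_uniq; clear; lia.
have [|w [z [s' [[s'_enum pw pwB] [deg_z gap_p le_g] le_gaps]]]] :=
    @rotate_gap n x0 M B' s p d s_enum p_gap d_gt.
  have := bound' p p_gap; have := level_leq p_gap; move: high d_leq_n b_leq_d.
  by clear; card_lia.
set M' := [set p; w] |: M in gap_p le_g le_gaps.
have s'_uniq : uniq s' by rewrite (perm_uniq s'_enum) enum_uniq.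
have rep1 : repairs M B s <= repairs M B' s by apply: repairs_mono.
have rep2 : repairs M B' s < repairs M' B' s'.
  apply: (@repairs_lt _ _ _ _ _ p) => // v dv; apply: le_gaps.
  by apply: contraTneq dv => ->; rewrite -leqNgt.
have rep3 := leq_ltn_trans rep1 rep2.
exists w, s'; rewrite /= -/M'; split=> //; split=> //.
  move: cardB' budget le_g rep3; clear; move: (#|_|) (#|_|) (num_gaps _ _) (num_gaps _ _).
  by move: (repairs _ _ _) (repairs _ _ _); nia.
exists x => v v_gap; have [->|vz] := eqVneq v z.
  apply: leq_trans deg_z _; apply: leq_trans (_ : level M' s' z <= _).
    by rewrite /level leq_pmulr //; have := gaps_at_leq2 x0 M' z s'_uniq; clear; lia.
  by rewrite -!addnA leq_addr.
(* If [p] still has a gap, it went from two to one, so its level rose by [d], more than the excess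
   [3206 * b + 2]. *)
have [vp|vp] := eqVneq v p.
  rewrite vp in v_gap *; have := gaps_at_leq2 x0 M p s_uniq; have := bound' p p_gap.
  move: v_gap gap_p b_leq_d; rewrite /level; clear.
  by move: (gaps_at M' s' p) (gaps_at M s p) => k' k; nia.
have v_gap0 : 0 < gaps_at M s v by apply: leq_trans v_gap (le_gaps v vz).
have := level_mono (le_gaps v vz).
have [dv|] := boolP (in_danger M B' s v); last first.
  rewrite /in_danger v_gap0 -leqNgt => h1 h2; apply: leq_trans h1 (leq_trans h2 _).
  by rewrite -!addnA leq_addr.
have vc : v != c by apply/eqP=> vc; rewrite vc in dv vp; rewrite (p_c dv) eqxx in vp.
have := degB' v; rewrite (negPf vc) -/B'; have := bound v v_gap0; move: rep3.
by clear; case: (v == x); card_lia.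
Qed.

(** In the induction measure, a repair increases [repairs] without adding gaps, and a double threat
    removes a gap without decreasing [repairs]. *)
Lemma maker_wins_resting M B s : resting M B s ->
  maker_wins b (@has_hamiltonian_path n) Breaker M B.
Proof.
have mono := @has_hamiltonian_path_mono n.
have n_gt0 : 0 < n by move: (ltn_ord x0); clear; lia.
have [m] := ubnP (num_gaps M s + (2 * n - repairs M B s)).
elim: m => // m IHm in M B s * => lt_m rest.
have [s_enum budget _] := rest.
have [le_g1|g_gt1] := leqP (num_gaps M s) 1.
  by apply: maker_wins_now => //; apply: hamiltonian_of_gaps s_enum le_g1.
apply: maker_wins_reply => //; move=> S [_ cardS [c cS]].
have [/existsP[p0 p0_danger]|] := boolP [exists p, in_danger M (B :|: S) s p].
  have [p p_danger p_c] : exists2 p, in_danger M (B :|: S) s p &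
      in_danger M (B :|: S) s c -> p = c.
    have [c_danger|c_safe] := boolP (in_danger M (B :|: S) s c); first by exists c.
    by exists p0.
  have [w [s' [pw pwB rest' le_g lt_r]]] := repair_danger rest cardS cS p_danger p_c.
  apply: (@maker_wins_claim _ _ _ _ _ [set p; w]); rewrite ?in_complete //.
  apply: IHm rest'; have := repairs_leq ([set p; w] |: M) (B :|: S) s'.
  by move: lt_m le_g lt_r; clear; lia.
rewrite negb_exists => /forallP safe; set B1 := B :|: S in safe *.
have safe_deg v : 0 < gaps_at M s v -> degree B1 v <= level M s v.
  by move=> v_gap; have := safe v; rewrite /in_danger v_gap /= -leqNgt.
have cardB1 : #|B1| <= #|B| + b.
  by apply: leq_trans (leq_card_setU _ _) _; rewrite leq_add2l.
have [D [Q [DQs ces [D0 Q0 le_DQ] [pyM p2M]]]] := two_gaps_split g_gt1.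
have DQ_enum := perm_trans DQs s_enum.
have gapsE v : gaps_at M (D ++ Q) v = gaps_at M s v by apply: ces.
have deg e v : e \in cycle_edges x0 (D ++ Q) -> e \notin M -> v \in e -> degree B1 v <= 2 * d.
  move=> es eM ve; have := gaps_at_gt0 es eM ve; rewrite gapsE => v_gap.
  exact: leq_trans (safe_deg v v_gap) (level_leq v_gap).
have py_edge : [set last x0 D; head x0 Q] \in cycle_edges x0 (D ++ Q).
  by rewrite /cycle_edges (path_edges_cat x0) // in_cons mem_cat mem_head !orbT.
have p2_edge : [set last x0 Q; head x0 D] \in cycle_edges x0 (D ++ Q).
  by rewrite /cycle_edges last_catr // head_catl // mem_head.
have [||w [e1 [e2 [pw pwB [e1K e2K e1B e2B e12] merge]]]] :=
    @merge_threats n x0 M B1 D Q (2 * d) DQ_enum _ pyM p2M.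
- split=> //; have : size (D ++ Q) = n by rewrite (perm_size DQ_enum) size_enum_ord.
  by rewrite size_cat; move: le_DQ d_leq_n b_leq_d; move: (size D) (size Q); clear; lia.
- split; [apply: (deg _ _ py_edge pyM)|apply: (deg _ _ py_edge pyM)|
    apply: (deg _ _ p2_edge p2M)]; by rewrite ?set21 ?set22.
apply: (@maker_wins_claim _ _ _ _ _ [set last x0 D; w]); rewrite ?in_complete //.
set M1 := _ |: M; apply: maker_wins_reply => //; move=> S2 [_ cardS2 [c2 c2S]].
have finish e : e \in complete_graph n -> e \notin B1 -> e = e1 \/ e = e2 ->
    e \notin S2 -> maker_wins b (@has_hamiltonian_path n) Maker M1 (B1 :|: S2).
  move=> eK eB e_or eS2; apply: (@maker_wins_claim _ _ _ _ _ e) => //.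
    by rewrite inE negb_or eB.
  have MM2 : M \subset e |: M1.
    by apply: subset_trans (subsetUr _ _) (subsetUr _ _).
  have [||s' [s'_enum lt_g le_gaps]] := merge _ MM2.
  - by rewrite !in_setU1 eqxx orbT.
  - by case: e_or => <-; [left|right]; rewrite setU11.
  have gs' v : gaps_at (e |: M1) s' v <= gaps_at M s v by rewrite -gapsE.
  have lt_g' : num_gaps (e |: M1) s' < num_gaps M s by rewrite -[num_gaps M s]ces.
  have rep : repairs M B s <= repairs (e |: M1) (B1 :|: S2) s'.
    apply: repairs_mono => //; apply: subset_trans (subsetUl _ _) (subsetUl _ _).
  apply: (IHm _ _ s').
    rewrite ltnS in lt_m; apply: leq_trans lt_m; rewrite -addSn.
    by apply: leq_add => //; apply: leq_sub2l.
  split=> //.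
    have : #|B1 :|: S2| <= #|B1| + b.
      by apply: leq_trans (leq_card_setU _ _) _; rewrite leq_add2l.
    move: cardB1 budget lt_g' rep; clear.
    move: (#|_|) (#|_|) (#|_|) (num_gaps _ _) (num_gaps _ _).
    by move: (repairs _ _ _) (repairs _ _ _); nia.
  (* Before [S2] all degrees at gaps were within their levels, so the bound starts afresh with the
     centre of [S2]. *)
  exists c2 => v v_gap; have v_gap0 := leq_trans v_gap (gs' v).
  have le_deg := leq_trans (safe_deg v v_gap0) (level_mono (gs' v)).
  apply: leq_trans (degree_breaker_move B1 v cardS2 c2S) _.
  apply: leq_trans (leq_add le_deg (leqnn _)) _.
  by rewrite -!addnA leq_add2l; move: (repairs _ _ _); clear; case: (v == c2); lia.
have [e1S|] := boolP (e1 \in S2); last by apply: finish => //; left.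
apply: (finish e2) => //; first by right.
by apply/negP=> /c2S c2e2; have := disjointFr e12 (c2S _ e1S); rewrite c2e2.
Qed.

Lemma resting_init : resting set0 set0 (enum 'I_n).
Proof.
have deg0 v : degree set0 v = 0.
  by apply/eqP; rewrite -leqn0 -(cards0 {set 'I_n}); apply: degree_leq_card.
split=> //; last by exists x0 => v _; rewrite deg0.
have n_gt0 : 0 < n by move: (ltn_ord x0); clear; lia.
have : num_gaps set0 (enum 'I_n) <= size (enum 'I_n).
  by apply: num_gaps_leq; rewrite -size_eq0 size_enum_ord; move: n_gt0; clear; lia.
by rewrite size_enum_ord cards0; clear; nia.
Qed.

End MakerHamiltonian.

(** Here [d] is [n %/ 100]. From [100 <= d] follows [n <= 200 * d], and together with
    [10000 * b <= d] also [3300 * b + 10 <= d]. *)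
Lemma maker_wins_hamiltonian n b p : 100 * 100 <= n -> 100 * (100 * (100 * b)) <= n ->
  maker_wins b (@has_hamiltonian_path n) p set0 set0.
Proof.
move=> n_big b_small; have n_gt0 : 0 < n by apply: leq_trans n_big.
apply: maker_wins_first; first exact: has_hamiltonian_path_mono.
have d_big : 100 <= n %/ 100 by rewrite leq_divRL.
have d_b : 100 * (100 * b) <= n %/ 100 by rewrite leq_divRL // mulnC.
have n_d : n %/ 100 * 100 <= n by rewrite leq_trunc_div.
have d_n : n < (n %/ 100).+1 * 100 by rewrite ltn_ceil.
apply: (@maker_wins_resting _ (Ordinal n_gt0) _ (n %/ 100)) (resting_init _ _ _).
- by rewrite mulnC.
- by move: (n %/ 100) d_big d_n => d; clear; lia.
- by move: (n %/ 100) d_big d_b => d; clear; lia.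
Qed.

(* Linear thresholds *)
From HB Require Import structures.
From mathcomp Require Import all_boot all_order all_algebra.
From mathcomp Require Import all_classical all_reals all_analysis.
Import numFieldNormedType.Exports.
Import Order.TTheory GRing.Theory Num.Theory.
Local Open Scope classical_set_scope.
Local Open Scope ring_scope.

Lemma linear_eqTheta (R : realType) (f : nat -> nat) (c N : nat) : (0 < c)%N ->
  (forall n, (N <= n)%N -> (n <= c * f n)%N /\ (f n <= n)%N) ->
  (fun n => (f n)%:R : R) =Theta_\oo (fun n => n%:R : R).
Proof.
move=> c_gt0 f_lin; rewrite eqThetaE qualifE; apply/asboolP.
exists (c%:R^-1, 1) => /=; first by rewrite invr_gt0 ltr0n c_gt0 ltr01.
exists N => // n /= /f_lin[n_cf f_n]; rewrite !normr_nat mul1r ler_nat; split=> //.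
by rewrite ler_pdivrMl ?ltr0n // -natrM ler_nat.
Qed.

(** For large [n] the threshold lies between [n %/ c] and [n]; [choice] turns these values into a
    function. *)
Lemma threshold_linear (R : realType) (first : player) (W : forall n, graph n -> Prop)
    (c N : nat) : (0 < c)%N ->
  (forall n b, (N <= n)%N -> (c * b <= n)%N ->
    maker_wins b (@W n) first finset.set0 finset.set0) ->
  (forall n b, (N <= n)%N -> (n < b)%N ->
    breaker_wins b (@W n) first finset.set0 finset.set0) ->
  exists2 b0 : nat -> nat,
    \forall n \near \oo, threshold_bias first (@W n) (b0 n)
    & (fun n => (b0 n)%:R : R) =Theta_\oo (fun n => n%:R : R).
Proof.
move=> c_gt0 maker breaker.
have thr n : exists b0, (N <= n)%N ->
    (n %/ c <= b0 <= n)%N /\ threshold_bias first (@W n) b0.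
  have [le_Nn|_] := leqP N n; last by exists 0%N.
  have [||b b0] := @threshold_exists n (n %/ c)%N first (@W n) (leq_div _ _).
  - by apply: maker => //; rewrite mulnC leq_trunc_div.
  - by move=> b; apply: breaker.
  by exists b.
have [b0 b0P] := choice thr; exists b0.
  by exists N => // n /= /b0P[].
(* The factor two absorbs the rounding: [n < (n %/ c).+1 * c], and [n %/ c] is positive once
   [c <= n]. *)
apply: (@linear_eqTheta R b0 (2 * c) (maxn N c)); first by rewrite muln_gt0.
move=> n; rewrite geq_max => /andP[/b0P[/andP[lo hi] _] le_cn]; split=> //.
have := ltn_ceil n c_gt0; have : (0 < n %/ c)%N by rewrite divn_gt0.
by move: (n %/ c)%N (b0 n) lo => q m; clear; nia.
Qed.

Theorem theorem1p6 (R : realType) (first : player) :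
  [/\ exists2 b0 : nat -> nat,
        \forall n \near \oo, threshold_bias first (@has_triangle n) (b0 n)
        & (fun n => (b0 n)%:R : R) =Theta_\oo (fun n => n%:R : R),
      exists2 b0 : nat -> nat,
        \forall n \near \oo, threshold_bias first (@has_spanning_tree n) (b0 n)
        & (fun n => (b0 n)%:R : R) =Theta_\oo (fun n => n%:R : R)
    & exists2 b0 : nat -> nat,
        \forall n \near \oo,
          threshold_bias first (@has_hamiltonian_path n) (b0 n)
        & (fun n => (b0 n)%:R : R) =Theta_\oo (fun n => n%:R : R)].
Proof.
(* One strategy for each player serves both the connectivity and the Hamiltonicity game, since a
   Hamiltonian path yields a spanning tree. *)
have hamiltonian n b : (100 * 100 <= n)%N -> (100 * (100 * 100) * b <= n)%N ->
    maker_wins b (@has_hamiltonian_path n) first finset.set0 finset.set0.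
  by move=> n_big b_small; apply: maker_wins_hamiltonian => //; rewrite !mulnA in b_small *.
have isolate n b : (100 * 100 <= n)%N -> (n < b)%N ->
    breaker_wins b (@has_spanning_tree n) first finset.set0 finset.set0.
  by move=> n_big /ltnW; apply: breaker_wins_isolate; apply: leq_trans n_big.
split.
- apply: (@threshold_linear R first has_triangle 10 10) => // n b n_big.
    by move=> b_small; apply: maker_wins_triangle; move: n_big b_small; clear; lia.
  by move/ltnW; apply: breaker_wins_triangle.
- apply: (@threshold_linear R first has_spanning_tree (100 * (100 * 100)) (100 * 100)) => //.
  move=> n b n_big b_small; apply: maker_wins_weaken (hamiltonian n b n_big b_small).
  exact: hamiltonian_spanning_tree.
- apply: (@threshold_linear R first has_hamiltonian_path (100 * (100 * 100)) (100 * 100)) => //.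
  move=> n b n_big lt_nb; apply: breaker_wins_weaken (isolate n b n_big lt_nb).
  exact: hamiltonian_spanning_tree.
Qed.
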